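(* Let $d_v \geq 1$ and $d_c \geq 5$ be integers. There exists $\eta > 0$ (depending on $d_c$) such that, with probability tending to $1$ as $n \to \infty$, the parity-check graph $B$ of a random $(d_v,d_c)$-LDPC code with block length $n$ has the following property: for every received vector $s \in \{0,1\}^n$, there is a solution to $\eta n$ rounds of the Sherali-Adams hierarchy for the Nearest Codeword instance defined by $B$ and $s$ that satisfies every constraint and is $p$-biased, where $p = 1/(d_c-3)$ if $d_c$ is odd and $p = 1/(d_c-4)$ if $d_c$ is even. In particular, its value $\frac{1}{n}\sum_{v} X_{\{v\}}(v\mapsto 1)$ equals $p$.
   Context: Random $(d_v,d_c)$-LDPC code: let $n$ be the block length and $m$ the number of checks, with $M := n d_v = m d_c$. Assign $d_v$ sockets to each of $n$ left (variable) vertices and $d_c$ sockets to each of $m$ right (check) vertices, numbering the sockets $1,\dots,M$ on each side. Sample a uniformly random permutation $\pi$ of $\{1,\dots,M\}$ and join left socket $i$ to right socket $\pi(i)$. The parity-check graph $B=(L\cup R,E_B)$ has an edge between variable $i$ and check $j$ iff there is an odd number of socket edges between them. Nearest Codeword instance defined by $B$ (with $|L|=n$) and a received vector $s\in\{0,1\}^n$: variables are the elements of $L$, each taking values in $\{0,1\}$; for each check $j$ with neighborhood $N(j)\subseteq L$ there is a constraint on the variables of $N(j)$ requiring $\sum_{v\in N(j)} x_v \equiv \sum_{v\in N(j)} s_v \pmod 2$ (an ''odd'' or ''even'' parity predicate on $|N(j)|$ bits). Sherali-Adams: for a set $V$ of variables with values in a finite set $G$, a $t$-local distribution is a collection $\{X_S(\alpha)\in[0,1]\}$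 indexed by $S\subseteq V$, $|S|\le t$, $\alpha:S\to G$, with $X_\emptyset=1$ and, for all $S\subseteq T\subseteq V$ with $|T|\le t$ and $\alpha:S\to G$, $\sum_{\beta:T\setminus S\to G}X_T(\alpha\circ\beta)=X_S(\alpha)$, where $\alpha\circ\beta$ is the assignment on $T$ extending both. A solution to $t$ rounds of the Sherali-Adams hierarchy (with $t$ at least the maximum constraint arity) is a $t$-local distribution; it satisfies a constraint with scope $(e_1,\dots,e_k)$ and predicate $P\subseteq G^k$ if $X_{\{e_1,\dots,e_k\}}(\alpha)=0$ whenever $(\alpha(e_1),\dots,\alpha(e_k))\notin P$. For $G=\{0,1\}$ the solution is $p$-biased if $X_{\{v\}}(v\mapsto 1)=p$ for all $v\in V$.
   Formalization: The constant η may depend on d_v as well as on d_c; an η depending on d_c alone and serving all d_v is impossible (for d_c = 5 and d_v large, the checks inside ηn variables force most of them). *)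

(* Defs.v *)
From HB Require Import structures.
From mathcomp Require Import all_boot all_order all_fingroup all_algebra.
From mathcomp Require Import all_classical all_reals all_analysis.
Set Implicit Arguments.
Unset Strict Implicit.
Unset Printing Implicit Defensive.
Import Order.TTheory GRing.Theory Num.Theory.
Import numFieldNormedType.Exports.

Local Open Scope set_scope.
Local Open Scope ring_scope.

Section SheraliAdams.
Variables (V G : finType).

Definition asg (S : {set V}) : finType := {ffun {x : V | x \in S} -> G}.

Lemma mem_setD_sub (S T : {set V}) (x : {x : V | x \in T}) :
  val x \notin S -> val x \in T :\: S.
Proof. by move=> xS; rewrite finset.in_setD xS (valP x). Qed.

(* The assignment alpha o beta on T.  When S is a subset of T it extends both
   alpha and beta. *)
Definition asg_union (S T : {set V}) (alpha : asg S) (beta : asg (T :\: S)) :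
    asg T :=
  [ffun x : {x : V | x \in T} =>
     match boolP (val x \in S) with
     | AltTrue xS => alpha (exist _ (val x) xS)
     | AltFalse xNS => beta (exist _ (val x) (mem_setD_sub xNS))
     end].

Record constraint := Constraint {
  arity : nat;
  scope : 'I_arity -> V;
  accepts : {set {ffun 'I_arity -> G}}
}.

Definition scope_set (c : constraint) : {set V} :=
  [set scope i | i in [set: 'I_(arity c)]].

Definition read_scope (c : constraint) (alpha : asg (scope_set c)) :
    {ffun 'I_(arity c) -> G} :=
  [ffun i => alpha (exist _ (scope i) (imset_f (@scope c) (finset.in_setT i)))].

Variable R : realType.

(* X is a total family; its values at sets of more than t variables are
   irrelevant. *)
Record local_distribution (t : nat) (X : forall S : {set V}, asg S -> R) :
    Prop := LocalDistribution {
  ld_range : forall (S : {set V}) (alpha : asg S),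
    (#|S| <= t)%N -> 0 <= X S alpha <= 1;
  ld_empty : forall alpha : asg finset.set0, X finset.set0 alpha = 1;
  ld_consistent : forall (S T : {set V}) (alpha : asg S),
    S \subset T -> (#|T| <= t)%N ->
    \sum_(beta : asg (T :\: S)) X T (asg_union alpha beta) = X S alpha
}.

Definition SA_solution (t : nat) (J : Type) (inst : J -> constraint)
    (X : forall S : {set V}, asg S -> R) : Prop :=
  (forall j, (arity (inst j) <= t)%N) /\ local_distribution t X.

Definition satisfies (X : forall S : {set V}, asg S -> R) (c : constraint) :
    Prop :=
  forall alpha : asg (scope_set c),
    read_scope alpha \notin accepts c -> X (scope_set c) alpha = 0.

End SheraliAdams.

Section Boolean.
Variables (V : finType) (R : realType).

Definition marginal1 (X : forall S : {set V}, asg bool S -> R) (v : V) : R :=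
  X [set v] [ffun=> true].

Definition biased (p : R) (X : forall S : {set V}, asg bool S -> R) : Prop :=
  forall v, marginal1 X v = p.

End Boolean.

Definition SA_value (R : realType) (n : nat)
    (X : forall S : {set 'I_n}, asg bool S -> R) : R :=
  n%:R^-1 * \sum_(v < n) marginal1 X v.

Section Codes.
Variables (n m : nat).

Definition neighbors (B : 'I_n -> 'I_m -> bool) (j : 'I_m) : {set 'I_n} :=
  [set v | B v j].

Definition nearest_codeword (B : 'I_n -> 'I_m -> bool)
    (s : {ffun 'I_n -> bool}) (j : 'I_m) : constraint 'I_n bool :=
  @Constraint 'I_n bool #|neighbors B j|
    (fun i => enum_val i)
    [set b : {ffun 'I_#|neighbors B j| -> bool} |
       odd (\sum_i b i)%N == odd (\sum_(v in neighbors B j) s v)%N].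

(* Sockets are numbered from 0: left socket i belongs to variable i %/ dv, and
   right socket k belongs to check k %/ dc.  Both sides have n * dv = m * dc
   sockets. *)
Definition ldpc_graph (dv dc : nat) (pi : {perm 'I_(n * dv)})
    (v : 'I_n) (j : 'I_m) : bool :=
  odd #|[set i : 'I_(n * dv) |
          (i %/ dv == v :> nat)%N && (pi i %/ dc == j :> nat)%N]|.

End Codes.

Definition equiprob (R : realType) (T : finType) (E : T -> Prop) : R :=
  #|[set x : T | `[< E x >]]|%:R / #|T|%:R.

Definition bias (R : realType) (dc : nat) : R :=
  if odd dc then (dc - 3)%:R^-1 else (dc - 4)%:R^-1.

Definition has_biased_SA_solutions (R : realType) (n m : nat) (t : nat) (p : R)
    (B : 'I_n -> 'I_m -> bool) : Prop :=
  forall s : {ffun 'I_n -> bool},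
  exists X : forall S : {set 'I_n}, asg bool S -> R,
    [/\ SA_solution t (nearest_codeword B s) X,
        forall j, satisfies X (nearest_codeword B s j),
        biased p X
      & SA_value X = p].

(* Main.v *)
Require Import Defs.
From mathcomp Require Import all_boot all_order all_fingroup all_algebra.
From mathcomp Require Import all_classical all_reals all_analysis.
From mathcomp Require Import fintype finset zify ring lra.
Set Implicit Arguments.
Unset Strict Implicit.
Unset Printing Implicit Defensive.
Import Order.TTheory GRing.Theory Num.Theory.
Import numFieldNormedType.Exports.

(** Fix a density [f_j] for every check [j], with respect to the [p]-biased
    product measure on [{0,1}^n], that is supported on the required parity and
    has mean one given any two of the variables of [j].  A set [S] of variables
    receives the marginal on [S] of the product of the densities of the checks
    in the core of [S].  The core is what remains when a check sharing at most
    two variables with [S] and the other checks is repeatedly removed: such a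
    density can be summed out, so cores of larger sets induce the same marginals.

    In a random graph, with probability [1 - O(1/n)], every set of [k <= 4t]
    checks reaches at least [(dc - 6/5) k] variables.  Then a set of checks from
    which no check can be removed has at most [(5/3) |S|] elements, and small
    cores exist.  A constant number of checks may still see one variable twice,
    which cancels; these keep [dc - 2] neighbours, and for them mean one given a
    single variable is enough.  For the stated [p] the first two
    moments are attained by the weights 0, 2, 4 when the parity is even, and by
    1, 3 and the largest odd weight when it is odd. *)

Local Open Scope ring_scope.

(** * Biased product measure and peeling *)

Section BiasedCube.
Variables (R : realFieldType) (V : finType) (p : R).
Implicit Types (x y : {ffun V -> bool}) (N A D : {set V}).

Definition bit_weight (b : bool) : R := if b then p else 1 - p.

Definition cube_weight x : R := \prod_v bit_weight (x v).

Lemma cube_weight_ge0 x : 0 <= p <= 1 -> 0 <= cube_weight x.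
Proof.
by move=> /andP[p0 p1]; apply: prodr_ge0 => v _; rewrite /bit_weight; case: ifP; lra.
Qed.

Lemma sum_cube_weight : \sum_x cube_weight x = 1.
Proof.
rewrite /cube_weight -(bigA_distr_bigA (fun _ => bit_weight)) big1 // => v _.
by rewrite big_bool /bit_weight /= addrCA subrr addr0.
Qed.

Definition ones N x : nat := #|[set v in N | x v]|.

Definition erase D x : {ffun V -> bool} := [ffun v => (v \notin D) && x v].

(** A point of the fiber is determined by its set of ones in [D]; grouping these sets by size gives
    the binomial sum. *)
Lemma sum_erase_fiber D y (psi : nat -> R) : erase D y = y ->
  \sum_(x | erase D x == y) cube_weight x * psi (ones D x) =
  (\prod_(v in ~: D) bit_weight (y v)) *
  \sum_(i < #|D|.+1) 'C(#|D|, i)%:R * (p ^+ i * (1 - p) ^+ (#|D| - i)) * psi i.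
Proof.
move=> yD.
pose h (Z : {set V}) : {ffun V -> bool} :=
  [ffun v => if v \in D then v \in Z else y v].
have hK (Z : {set V}) : Z \subset D -> [set v in D | h Z v] = Z.
  move=> ZD; apply/setP => v; rewrite !inE ffunE.
  by case: (boolP (v \in D)) => //= vD; apply/esym/negbTE/(contra _ vD)/(subsetP ZD).
have h_fiber (Z : {set V}) : (erase D (h Z) == y).
  apply/eqP/ffunP => v; rewrite -[in RHS]yD !ffunE.
  by case: (v \in D).
have hK' x : erase D x == y -> h [set v in D | x v] = x.
  move=> /eqP xy; apply/ffunP => v; rewrite ffunE inE.
  by case: (boolP (v \in D)) => //= vD; rewrite -xy ffunE vD.
rewrite (reindex_onto h (fun x => [set v in D | x v])); last by move=> x; exact: hK'.
rewrite (eq_bigl (fun Z : {set V} => Z \subset D)); last first.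
  move=> Z; rewrite h_fiber /=; apply/eqP/idP => [<-|/hK //].
  by apply/subsetP => v; rewrite inE => /andP[].
rewrite (eq_bigr (fun Z : {set V} => (\prod_(v in ~: D) bit_weight (y v)) *
    ((p ^+ #|Z| * (1 - p) ^+ (#|D| - #|Z|)) * psi #|Z|))); last first.
  move=> Z ZD; rewrite /ones hK // mulrA; congr (_ * _).
  rewrite /cube_weight (bigID (mem D)) /= mulrC; congr (_ * _).
    apply: eq_big => [v|v vD]; first by rewrite inE.
    by rewrite ffunE (negbTE vD).
  rewrite (bigID (mem Z)) /=; congr (_ * _).
    rewrite (eq_bigl (mem Z)); last first.
      by move=> v /=; case: (boolP (v \in Z)) => [/(subsetP ZD)->|_]; rewrite ?andbF.
    rewrite (eq_bigr (fun=> p)) ?prodr_const //.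
    by move=> v /= vZ; rewrite ffunE (subsetP ZD) // vZ.
  rewrite -(_ : #|D :\: Z| = #|D| - #|Z|)%N; last first.
    by rewrite cardsD (setIidPr ZD).
  rewrite (eq_bigl (mem (D :\: Z))); last by move=> v; rewrite !inE andbC.
  rewrite (eq_bigr (fun=> 1 - p)) ?prodr_const // => v.
  by rewrite !inE ffunE => /andP[/negbTE-> ->].
rewrite -big_distrr /=; congr (_ * _).
rewrite (partition_big (fun Z : {set V} => inord #|Z| : 'I_#|D|.+1) xpredT) //=.
apply: eq_bigr => i _.
rewrite (eq_big (fun Z : {set V} => Z \in [set Z : {set V} | Z \subset D & #|Z| == i])
   (fun=> (p ^+ i * (1 - p) ^+ (#|D| - i)) * psi i)); last 2 first.
- move=> Z; rewrite inE; case: (boolP (Z \subset D)) => //= ZD.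
  by rewrite -val_eqE /= inordK // ltnS subset_leq_card.
- move=> Z /andP[ZD /eqP <-].
  by rewrite inordK // ltnS subset_leq_card.
by rewrite sumr_const cards_draws mulr_natl mulrnAl.
Qed.

(* [phi], read as a density with respect to the biased product measure on [k]
   bits, has mean one once any [r] of the bits are fixed. *)
Definition unit_mean (k r : nat) (phi : nat -> R) : Prop :=
  forall c, (c <= r)%N ->
    \sum_(i < (k - r).+1)
      'C(k - r, i)%:R * (p ^+ i * (1 - p) ^+ (k - r - i)) * phi (c + i)%N = 1.

Definition depends_on A (h : {ffun V -> bool} -> R) : Prop :=
  forall x y, {in A, x =1 y} -> h x = h y.

(** Pads the bits fixed by [A] to exactly [r], the number used by [unit_mean]; the union bound pads
    reached sets in the same way. *)
Lemma setI_extend A N r : (#|N :&: A| <= r <= #|N|)%N ->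
  exists2 B : {set V}, N :&: A \subset B /\ B \subset N & #|B| = r.
Proof.
move=> /andP[NAr rN].
have : (r - #|N :&: A| <= #|N :\: A|)%N by rewrite leq_subLR cardsID.
move=> /card_geqP[s [us ss sN]].
have dsj : [disjoint N :&: A & [set v in s]].
  rewrite -setI_eq0; apply/eqP/setP => v; rewrite !inE.
  apply/negbTE/negP => /andP[/andP[_ vA] /sN]; rewrite !inE => /andP[].
  by rewrite vA.
exists (N :&: A :|: [set v in s]).
  split; first exact: subsetUl.
  rewrite subUset subsetIl /=; apply/subsetP => v; rewrite inE => /sN.
  by rewrite inE => /andP[].
rewrite cardsU (_ : _ :&: [set v in s] = set0); last by apply/eqP; rewrite setI_eq0.
have -> : #|[set v in s]| = size s by rewrite cardsE; apply/card_uniqP.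
by rewrite cards0 subn0 ss subnKC.
Qed.

(** With the bits of [N] seen by [h] padded to a set [B] of size [r], [h] is constant on each fiber
    of [erase (N :\: B)], and [phi] averages to one there. *)
Lemma sum_unit_mean N A r phi h :
  (#|N :&: A| <= r <= #|N|)%N -> unit_mean #|N| r phi -> depends_on A h ->
  \sum_x cube_weight x * h x * phi (ones N x) = \sum_x cube_weight x * h x.
Proof.
move=> /setI_extend[B [NAB BN] cB] phi1 hA.
set D := N :\: B.
have cD : #|D| = (#|N| - r)%N by rewrite cardsD (setIidPr BN) cB.
have eraseK x : erase D (erase D x) = erase D x.
  by apply/ffunP => v; rewrite !ffunE andbA andbb.
have partD F : \sum_x F x =
    \sum_(y | erase D y == y) \sum_(x | erase D x == y) F x :> R.
  by rewrite (partition_big (erase D) (fun y => erase D y == y)) //= => x _; rewrite eraseK.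
rewrite !partD; apply: eq_bigr => y /eqP yD.
have hy x : erase D x == y -> h x = h y.
  move=> /eqP <-; apply: hA => v vA; rewrite ffunE !inE.
  case: (boolP (v \in N)) => vN; rewrite ?andbF //= andbT.
  by rewrite (subsetP NAB) // inE vN.
have onesE x : erase D x == y -> ones N x = (ones B y + ones D x)%N.
  move=> /eqP <-; rewrite /ones -(cardsID B); congr (_ + _)%N; apply: eq_card => v.
    rewrite !inE ffunE !inE; case: (boolP (v \in B)) => //= vB.
      by rewrite (subsetP BN) // andbT.
    by rewrite andbF.
  by rewrite !inE andbA.
have mass (psi : nat -> R) :
    \sum_(i < #|D|.+1) 'C(#|D|, i)%:R * (p ^+ i * (1 - p) ^+ (#|D| - i)) * psi i = 1 ->
    \sum_(x | erase D x == y) cube_weight x * h x * psi (ones D x) =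
      h y * \prod_(v in ~: D) bit_weight (y v).
  move=> psi1; rewrite (eq_bigr (fun x => h y * (cube_weight x * psi (ones D x)))).
    by rewrite -big_distrr sum_erase_fiber //= psi1 mulr1.
  by move=> x xy; rewrite hy // (mulrC _ (h y)) mulrA.
rewrite (eq_bigr (fun x => cube_weight x * h x * phi (ones B y + ones D x)%N)); last first.
  by move=> x xy; rewrite onesE.
rewrite (mass (fun i => phi (ones B y + i)%N)); last first.
  rewrite cD; apply: phi1; rewrite -cB subset_leq_card //.
  by apply/subsetP => v; rewrite inE => /andP[].
rewrite -(mass (fun=> 1)); last first.
  transitivity ((1 - p + p) ^+ #|D|); last by rewrite subrK expr1n.
  rewrite exprDn; apply: eq_bigr => i _.
  by rewrite mulr1 mulr_natl mulrC [in RHS]mulrC mulrC.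
by apply: eq_bigr => x _; rewrite mulr1.
Qed.

End BiasedCube.

Section Peeling.
Variables (V J : finType) (N : J -> {set V}) (r : J -> nat).
Implicit Types (S T : {set V}) (K L : {set J}).

Definition shared S K (j : J) : {set V} :=
  N j :&: (S :|: \bigcup_(i in K :\ j) N i).

(* When [j] in [K] shares at most [r j] variables with [S] and the rest of [K],
   its density can be summed out; [K] is stuck when no [j] can be removed so. *)
Definition stuck S K : bool := [forall j in K, (r j < #|shared S K j|)%N].

Lemma sharedS S T K L j : S \subset T -> K \subset L ->
  shared S K j \subset shared T L j.
Proof.
move=> ST KL; apply/setIS/setUSS => //; apply/bigcupsP => i iK.
by apply: bigcup_sup; move: iK; rewrite !inE => /andP[-> /(subsetP KL)].
Qed.

Lemma stuck_lt S T K L j : stuck S K -> S \subset T -> K \subset L -> j \in K ->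
  (r j < #|shared T L j|)%N.
Proof.
move=> /forall_inP sK ST KL jK; apply: leq_trans (sK j jK) _.
by apply: subset_leq_card; apply: sharedS.
Qed.

Lemma stuckSl S T K : S \subset T -> stuck S K -> stuck T K.
Proof. by move=> ST sK; apply/forall_inP => j; apply: stuck_lt sK _ _. Qed.

Lemma stuckU S K L : stuck S K -> stuck S L -> stuck S (K :|: L).
Proof.
move=> sK sL; apply/forall_inP => j; rewrite inE => /orP[]; apply: stuck_lt.
- exact: sK.
- by [].
- exact: subsetUl.
- exact: sL.
- by [].
- exact: subsetUr.
Qed.

Lemma stuck0 S : stuck S set0.
Proof. by apply/forall_inP => j; rewrite inE. Qed.

Section Sums.
Variables (R : realFieldType) (p : R) (phi : J -> nat -> R).
Hypothesis phi_mean : forall j, unit_mean p #|N j| (r j) (phi j).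
Hypothesis r_le : forall j, (r j <= #|N j|)%N.

Definition joint_density K (x : {ffun V -> bool}) : R :=
  \prod_(j in K) phi j (ones (N j) x).

(** [h] and the other densities depend only on [S] and the variables of [K :\ j], and [j] sees at
    most [r j] of these. *)
Lemma sum_joint_densityD1 S K j (h : {ffun V -> bool} -> R) : depends_on S h ->
  j \in K -> (#|shared S K j| <= r j)%N ->
  \sum_x cube_weight p x * (h x * joint_density K x) =
  \sum_x cube_weight p x * (h x * joint_density (K :\ j) x).
Proof.
move=> hS jK jr.
rewrite -(@sum_unit_mean _ _ p (N j) (S :|: \bigcup_(i in K :\ j) N i) (r j) (phi j)
  (fun x => h x * joint_density (K :\ j) x)) //; last 2 first.
- by rewrite jr r_le.
- move=> x y xy; congr (_ * _).
    by apply: hS => v vS; apply: xy; rewrite inE vS.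
  apply: eq_bigr => i iK; congr (phi i _); apply: eq_card => v; rewrite !inE.
  case: (boolP (v \in N i)) => //= vN; apply: xy; rewrite inE; apply/orP; right.
  by apply/bigcupP; exists i.
apply: eq_bigr => x _; rewrite /joint_density (big_setD1 j) //=.
by rewrite (mulrC (phi j _)) !mulrA.
Qed.

(** [K0] is the largest stuck subset of [K]. While the current set is not stuck, some check can be
    summed out, and by monotonicity it lies outside [K0]. *)
Lemma sum_joint_density_peel S K0 K (h : {ffun V -> bool} -> R) :
  depends_on S h -> stuck S K0 -> K0 \subset K ->
  (forall L, L \subset K -> stuck S L -> L \subset K0) ->
  \sum_x cube_weight p x * (h x * joint_density K x) =
  \sum_x cube_weight p x * (h x * joint_density K0 x).
Proof.
move=> hS sK0; move: {2}#|K| (leqnn #|K|) => n.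
elim: n K => [|n IHn] K Kn K0K maxK.
  suff -> : K0 = K by [].
  move: Kn; rewrite leqn0 cards_eq0 => /eqP KE; apply/eqP.
  by rewrite eqEsubset K0K KE sub0set.
have [sK|/forall_inPn[j jK]] := boolP (stuck S K).
  suff -> : K0 = K by [].
  by apply/eqP; rewrite eqEsubset K0K maxK.
rewrite -leqNgt => jr; rewrite (sum_joint_densityD1 hS jK jr).
apply: IHn.
- by move: Kn; rewrite (cardsD1 j) jK.
- rewrite subsetD1 K0K /=; apply/negP => jK0.
  by move: jr; rewrite leqNgt (stuck_lt sK0).
- by move=> L LK; apply: maxK; apply: subset_trans LK (subsetDl _ _).
Qed.

End Sums.

Section Closure.
Variable t : nat.
Hypothesis stuck_small : forall S K,
  (#|S| <= t)%N -> (#|K| <= 4 * t)%N -> stuck S K -> (#|K| <= 2 * #|S|)%N.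

(** The size cutoff is there because [stuck_small] says nothing about stuck sets of more than
    [4 * t] checks. *)
Definition core S : {set J} := \bigcup_(K | stuck S K && (#|K| <= 2 * t)%N) K.

(* Two small stuck sets have a union of at most [4 * t] elements, which is then
   small again. *)
Lemma core_stuck S : (#|S| <= t)%N -> stuck S (core S) /\ (#|core S| <= 2 * t)%N.
Proof.
move=> St; rewrite /core.
apply: (big_ind (fun K => stuck S K /\ (#|K| <= 2 * t)%N)).
- by rewrite stuck0 cards0.
- move=> K L [sK Kt] [sL Lt].
  have sKL := stuckU sK sL; split=> //.
  apply: leq_trans (stuck_small St _ sKL) _; last by rewrite leq_mul2l St.
  by rewrite (leq_trans (leq_card_setU K L)) //; lia.
- by move=> K /andP[].
Qed.

Lemma core_max S K : (#|S| <= t)%N -> (#|K| <= 4 * t)%N -> stuck S K ->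
  K \subset core S.
Proof.
move=> St Kt sK; apply: bigcup_sup; rewrite sK /=.
by apply: leq_trans (stuck_small St Kt sK) _; rewrite leq_mul2l St.
Qed.

Lemma core_card S : (#|S| <= t)%N -> (#|core S| <= 2 * #|S|)%N.
Proof. by move=> St; have [sC Ct] := core_stuck St; apply: stuck_small => //; lia. Qed.

Lemma core0 : core set0 = set0.
Proof.
by apply/eqP; have := @core_card set0; rewrite cards0 muln0 leqn0 cards_eq0; apply.
Qed.

Lemma coreS S T : (#|T| <= t)%N -> S \subset T -> core S \subset core T.
Proof.
move=> Tt ST; have St := leq_trans (subset_leq_card ST) Tt.
have [sC Ct] := core_stuck St.
by apply: core_max => //; [lia|apply: stuckSl sC].
Qed.

(** A check shares all its variables with its own scope, so [[set j]] is stuck. The density of [j]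
    is thus present there and enforces the constraint. *)
Lemma mem_core j : (#|N j| <= t)%N -> (r j < #|N j|)%N -> j \in core (N j).
Proof.
move=> Nt rN; rewrite -sub1set; apply: core_max => //.
  by rewrite cards1; lia.
apply/forall_inP => i /set1P ->; rewrite /shared.
by rewrite (setIidPl _) ?subsetUl.
Qed.

(** With respect to [S], [core S] is the largest stuck subset of [core T], so peeling the latter
    ends at the former. *)
Lemma sum_core (R : realFieldType) (p : R) (phi : J -> nat -> R) S T
    (h : {ffun V -> bool} -> R) :
  (forall j, unit_mean p #|N j| (r j) (phi j)) -> (forall j, (r j <= #|N j|)%N) ->
  depends_on S h -> S \subset T -> (#|T| <= t)%N ->
  \sum_x cube_weight p x * (h x * joint_density phi (core T) x) =
  \sum_x cube_weight p x * (h x * joint_density phi (core S) x).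
Proof.
move=> phi1 r_le hS ST Tt; have St := leq_trans (subset_leq_card ST) Tt.
apply: (sum_joint_density_peel phi1 r_le hS).
- by case: (core_stuck St).
- exact: coreS.
- move=> L LT sL; apply: core_max => //.
  by rewrite (leq_trans (subset_leq_card LT)) //; case: (core_stuck Tt) => _; lia.
Qed.

End Closure.
End Peeling.

(** * Parity-supported densities *)

Section ParityDensity.
Variable R : realFieldType.
Implicit Types (p : R) (b : bool).

Lemma natr_bin2 n : 'C(n, 2)%:R = n%:R * (n%:R - 1) / 2 :> R.
Proof.
elim: n => [|n IHn]; first by rewrite bin0n mul0r mul0r.
by rewrite binS bin1 natrD IHn -natr1; field.
Qed.

Lemma natr_bin3 n : 'C(n, 3)%:R = n%:R * (n%:R - 1) * (n%:R - 2) / 6 :> R.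
Proof.
elim: n => [|n IHn]; first by rewrite bin0n !mul0r.
by rewrite binS natrD IHn natr_bin2 -natr1; field.
Qed.

Lemma natr_bin4 n :
  'C(n, 4)%:R = n%:R * (n%:R - 1) * (n%:R - 2) * (n%:R - 3) / 24 :> R.
Proof.
elim: n => [|n IHn]; first by rewrite bin0n !mul0r.
by rewrite binS natrD IHn natr_bin3 -natr1; field.
Qed.

Definition parity_density p k r b (phi : nat -> R) : Prop :=
  [/\ forall w, 0 <= phi w, forall w, odd w != b -> phi w = 0 & unit_mean p k r phi].

(* An exchangeable distribution on [k] bits giving mass [e.2] to each string of
   weight [e.1], for [e] in [s]; the equation for [c] says that [r] given bits,
   [c] of them ones, have the probability that they have in the product measure. *)
Lemma parity_density_of_masses p k r b (s : seq (nat * R)) :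
  0 < p < 1 -> (r <= k)%N ->
  {in s, forall e, odd e.1 = b /\ 0 <= e.2} ->
  (forall c, (c <= r)%N ->
    \sum_(e <- s) (if (c <= e.1)%N then 'C(k - r, e.1 - c)%:R * e.2 else 0) =
    p ^+ c * (1 - p) ^+ (r - c)) ->
  exists phi, parity_density p k r b phi.
Proof.
move=> /andP[p0 p1] rk sP sE; have q0 : 0 < 1 - p by rewrite subr_gt0.
(* The sum allows repeated weights, such as the zero padding. Dividing by the product measure of a
   string of weight [w] turns its mass into a density. *)
pose psi w : R := \sum_(e <- s) if w == e.1 then e.2 else 0.
exists (fun w => psi w / (p ^+ w * (1 - p) ^+ (k - w))); split.
- move=> w; apply: divr_ge0; last by rewrite mulr_ge0 ?exprn_ge0 ?ltW.
  rewrite /psi big_seq; apply: sumr_ge0 => e /sP[_ e0].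
  by case: ifP.
- move=> w wb; rewrite /psi big_seq big1 ?mul0r // => e /sP[eb _].
  by case: eqP => // we; move: wb; rewrite we eb eqxx.
- move=> c cr; have pq0 : p ^+ c * (1 - p) ^+ (r - c) != 0.
    by rewrite mulf_neq0 // expf_neq0 // gt_eqF.
  transitivity ((\sum_(i < (k - r).+1) 'C(k - r, i)%:R * psi (c + i)%N) /
      (p ^+ c * (1 - p) ^+ (r - c))).
    rewrite big_distrl /=; apply: eq_bigr => i _.
    have -> : (k - (c + i) = (r - c) + (k - r - i))%N by have := ltn_ord i; lia.
    rewrite !exprD; field.
    by rewrite !expf_neq0 ?gt_eqF.
  rewrite (_ : \sum_(i < _) _ = p ^+ c * (1 - p) ^+ (r - c)) ?divff // -sE //.
  under eq_bigr do rewrite big_distrr.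
  rewrite exchange_big /=; apply: eq_bigr => e _.
  case: (leqP c e.1) => ce; last first.
    by apply: big1 => i _; case: eqP; [lia|rewrite mulr0].
  have [ek|ek] := leqP (e.1 - c) (k - r).
    have ek' : (e.1 - c < (k - r).+1)%N by [].
    rewrite (bigD1 (Ordinal ek')) //= subnKC // eqxx big1 ?addr0 // => i.
    rewrite -val_eqE /= => ie; case: eqP; rewrite ?mulr0 //.
    by move: ie => /eqP; lia.
  rewrite bin_small // mul0r big1 // => i _.
  by case: eqP; rewrite ?mulr0 //; have := ltn_ord i; lia.
Qed.

Lemma invr_natr_itv y : (2 <= y)%N -> 0 < (y%:R^-1 : R) < 1.
Proof.
move=> y2; have y1 : 1 < y%:R :> R by rewrite (ltr_nat R 1).
by rewrite invr_gt0 (lt_trans ltr01 y1) invf_lt1 // (lt_trans ltr01 y1).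
Qed.

(* In the next four lemmas the masses solve the [r + 1] linear equations of
   [parity_density_of_masses] for [p = 1 / Y]; for [r = 1] two weights suffice
   and the third entry is padding. *)
Ltac solve_masses zE :=
  let e := fresh in
  move=> e; rewrite !inE => /or3P[] /eqP -> /=; (split; first by rewrite ?oddD ?zE);
  (apply: divr_ge0; [nra | by rewrite ?mulr_ge0 ?exprn_ge0 //; lra]).

Ltac solve_moment :=
  rewrite ?subn0 ?subSS ?subn0 ?bin0 ?bin1 ?natr_bin2 ?natr_bin3 ?natr_bin4 ?natrD;
  field; rewrite ?gt_eqF //; lra.

Lemma pair_density_odd_arity y b : (2 <= y)%N -> ~~ odd y ->
  exists phi, parity_density (y%:R^-1 : R) (y + 3) 2 b phi.
Proof.
move=> y2 yo; have p01 := invr_natr_itv y2.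
move: y2 yo p01 => /subnKC <-; move: (y - 2)%N => z zo p01.
have z0 : 0 <= z%:R :> R by exact: ler0n.
have zE : odd z = false by move: zo; rewrite oddD => /negbTE.
have YE : (2 + z)%:R = z%:R + 2 :> R by rewrite natrD addrC.
case: b.
  apply: (parity_density_of_masses (s := let Y := (2 + z)%:R : R in [::
    (1%N, (Y - 1) ^+ 2 / (Y ^+ 2 * (Y + 2)));
    (3%N, 6 * (Y - 1) / (Y ^+ 3 * (Y + 1) * (Y + 2)));
    ((2 + z + 3)%N, (Y ^+ 2 - 4 * Y + 6) / (Y ^+ 3 * (Y + 2)))])) => //.
  - by rewrite YE; solve_masses zE.
  - rewrite YE; have -> : (2 + z + 3 - 2 = z + 3)%N by lia.
    (* The all-ones string is compatible with the two fixed bits only when both are ones. *)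
    have K0 : 'C(z + 3, 2 + z + 3 - 0) = 0%N by rewrite bin_small //; lia.
    have K1 : 'C(z + 3, 2 + z + 3 - 1) = 0%N by rewrite bin_small //; lia.
    have K2 : 'C(z + 3, 2 + z + 3 - 2) = 1%N by rewrite (_ : _ - 2 = z + 3)%N ?binn //; lia.
    by case=> [|[|[|?]]] // _; rewrite !big_cons big_nil /= ?K0 ?K1 ?K2; solve_moment.
  apply: (parity_density_of_masses (s := let Y := (2 + z)%:R : R in [::
    (0%N, (Y - 1) * (2 * Y - 3) / (4 * Y ^+ 2));
    (2%N, (Y - 1) / (Y ^+ 2 * (Y + 2)));
    (4%N, 6 / (Y ^+ 3 * (Y + 1) * (Y + 2)))])) => //.
  - by rewrite YE; solve_masses zE.
  - rewrite YE; have -> : (2 + z + 3 - 2 = z + 3)%N by lia.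
    by case=> [|[|[|?]]] // _; rewrite !big_cons big_nil /=; solve_moment.
Qed.

Lemma pair_density_even_arity y b : (2 <= y)%N -> ~~ odd y ->
  exists phi, parity_density (y%:R^-1 : R) (y + 4) 2 b phi.
Proof.
move=> y2 yo; have p01 := invr_natr_itv y2.
move: y2 yo p01 => /subnKC <-; move: (y - 2)%N => z zo p01.
have z0 : 0 <= z%:R :> R by exact: ler0n.
have zE : odd z = false by move: zo; rewrite oddD => /negbTE.
have YE : (2 + z)%:R = z%:R + 2 :> R by rewrite natrD addrC.
case: b.
  apply: (parity_density_of_masses (s := let Y := (2 + z)%:R : R in [::
    (1%N, (2 * Y ^+ 3 + Y ^+ 2 - 13 * Y + 12) / (2 * Y ^+ 2 * (Y + 2) * (Y + 4)));
    (3%N, 3 * (3 * Y - 4) / (Y ^+ 3 * (Y + 2) * (Y + 4)));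
    ((2 + z + 3)%N, (Y ^+ 2 - 5 * Y + 12) / (Y ^+ 3 * (Y + 2) * (Y + 4)))])) => //.
  - by rewrite YE; solve_masses zE.
  - rewrite YE; have -> : (2 + z + 4 - 2 = z + 4)%N by lia.
    (* Such a string has a single zero: none, one or [z + 4] of them remain when zero, one or both
       fixed bits are ones. *)
    have K0 : 'C(z + 4, 2 + z + 3 - 0) = 0%N by rewrite bin_small //; lia.
    have K1 : 'C(z + 4, 2 + z + 3 - 1) = 1%N by rewrite (_ : _ - 1 = z + 4)%N ?binn //; lia.
    have K2 : 'C(z + 4, 2 + z + 3 - 2) = (z + 4)%N.
      by rewrite -bin_sub; [rewrite (_ : _ - _ = 1)%N ?bin1 //; lia|lia].
    by case=> [|[|[|?]]] // _; rewrite !big_cons big_nil /= ?K0 ?K1 ?K2; solve_moment.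
  apply: (parity_density_of_masses (s := let Y := (2 + z)%:R : R in [::
    (0%N, (4 * Y ^+ 3 - Y ^+ 2 - 27 * Y + 36) / (8 * Y ^+ 2 * (Y + 3)));
    (2%N, (2 * Y - 3) / (2 * Y ^+ 2 * (Y + 3)));
    (4%N, 9 / (Y ^+ 2 * (Y + 1) * (Y + 2) * (Y + 3)))])) => //.
  - by rewrite YE; solve_masses zE.
  - rewrite YE; have -> : (2 + z + 4 - 2 = z + 4)%N by lia.
    by case=> [|[|[|?]]] // _; rewrite !big_cons big_nil /=; solve_moment.
Qed.

Lemma single_density_odd_arity y b : (2 <= y)%N -> ~~ odd y ->
  exists phi, parity_density (y%:R^-1 : R) (y + 1) 1 b phi.
Proof.
move=> y2 yo; have p01 := invr_natr_itv y2.
move: y2 yo p01 => /subnKC <-; move: (y - 2)%N => z zo p01.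
have z0 : 0 <= z%:R :> R by exact: ler0n.
have zE : odd z = false by move: zo; rewrite oddD => /negbTE.
have YE : (2 + z)%:R = z%:R + 2 :> R by rewrite natrD addrC.
case: b.
  apply: (parity_density_of_masses (s := let Y := (2 + z)%:R : R in [::
    (1%N, (2 * Y - 1) / (2 * Y * (Y + 1)));
    (3%N, 3 / (Y ^+ 2 * (Y - 1) * (Y + 1)));
    (3%N, 0 / 1)])) => //.
  - by rewrite YE; solve_masses zE.
  - rewrite YE; have -> : (2 + z + 1 - 1 = z + 2)%N by lia.
    by case=> [|[|?]] // _; rewrite !big_cons big_nil /=; solve_moment.
  apply: (parity_density_of_masses (s := let Y := (2 + z)%:R : R in [::
    (0%N, (Y - 1) / (2 * Y));
    (2%N, 1 / Y ^+ 2);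
    (2%N, 0 / 1)])) => //.
  - by rewrite YE; solve_masses zE.
  - rewrite YE; have -> : (2 + z + 1 - 1 = z + 2)%N by lia.
    by case=> [|[|?]] // _; rewrite !big_cons big_nil /=; solve_moment.
Qed.

Lemma single_density_even_arity y b : (2 <= y)%N -> ~~ odd y ->
  exists phi, parity_density (y%:R^-1 : R) (y + 2) 1 b phi.
Proof.
move=> y2 yo; have p01 := invr_natr_itv y2.
move: y2 yo p01 => /subnKC <-; move: (y - 2)%N => z zo p01.
have z0 : 0 <= z%:R :> R by exact: ler0n.
have zE : odd z = false by move: zo; rewrite oddD => /negbTE.
have YE : (2 + z)%:R = z%:R + 2 :> R by rewrite natrD addrC.
case: b.
  apply: (parity_density_of_masses (s := let Y := (2 + z)%:R : R in [::
    (1%N, (Y - 1) / (Y * (Y + 2)));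
    (3%N, 6 / (Y ^+ 2 * (Y + 1) * (Y + 2)));
    (3%N, 0 / 1)])) => //.
  - by rewrite YE; solve_masses zE.
  - rewrite YE; have -> : (2 + z + 2 - 1 = z + 3)%N by lia.
    by case=> [|[|?]] // _; rewrite !big_cons big_nil /=; solve_moment.
  apply: (parity_density_of_masses (s := let Y := (2 + z)%:R : R in [::
    (0%N, (Y - 2) / (2 * Y));
    (2%N, 1 / (Y * (Y + 1)));
    (2%N, 0 / 1)])) => //.
  - by rewrite YE; solve_masses zE.
  - rewrite YE; have -> : (2 + z + 2 - 1 = z + 3)%N by lia.
    by case=> [|[|?]] // _; rewrite !big_cons big_nil /=; solve_moment.
Qed.

End ParityDensity.

(** * Expansion of the socket graph *)

Local Close Scope ring_scope.

Section Sockets.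
Variables (I V J : finType) (vs : I -> V) (cs : I -> J) (dc : nat).
Hypothesis cs_card : forall j, #|[set i | cs i == j]| = dc.
Implicit Types (K : {set J}) (S : {set V}).

Definition mult K (v : V) : nat := #|[set i | (cs i \in K) && (vs i == v)]|.

Definition reach K : {set V} := vs @: [set i | cs i \in K].

Definition odd_nbrs (j : J) : {set V} := [set v | odd (mult [set j] v)].

(** The lower bound [(dc - 6/5) * #|K|] on [#|reach K|], with denominators cleared. *)
Definition expanding (b : nat) : bool :=
  [forall (K : {set J} | #|K| <= b),
     5 * (dc * #|K|) <= 6 * #|K| + 5 * #|reach K|].

Lemma card_sockets K : #|[set i | cs i \in K]| = dc * #|K|.
Proof.
rewrite -sum1dep_card (partition_big cs (mem K)) //=.
rewrite (eq_bigr (fun=> dc)) ?sum_nat_const 1?mulnC // => j jK.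
rewrite -[RHS](cs_card j) -sum1dep_card; apply: eq_bigl => i.
by case: eqP => [->|]; rewrite ?andbF // andbT; exact: jK.
Qed.

Lemma sum_mult K (P : pred V) :
  \sum_(v | P v) mult K v = #|[set i | (cs i \in K) && P (vs i)]|.
Proof.
rewrite -sum1dep_card (partition_big vs P) /=; last by move=> i /andP[].
apply: eq_bigr => v Pv; rewrite /mult -sum1dep_card; apply: eq_bigl => i.
by case: eqP => [->|]; rewrite ?andbF // Pv !andbT.
Qed.

Lemma mem_reach K v : (v \in reach K) = (0 < mult K v).
Proof.
apply/imsetP/card_gt0P => [[i]|[i]].
  by rewrite inE => iK ->; exists i; rewrite inE iK eqxx.
by rewrite inE => /andP[iK /eqP <-]; exists i; rewrite ?inE.
Qed.

Lemma sum_mult1 j : \sum_v mult [set j] v = dc.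
Proof.
rewrite sum_mult -[RHS](cs_card j); apply: eq_card => i.
by rewrite !inE andbT.
Qed.

(** Expansion of the single check [j] gives at least [dc - 1] reached variables, hence at least
    [dc - 2] of odd multiplicity; their number has the parity of [dc]. *)
Lemma card_odd_nbrs b j : 0 < b -> expanding b ->
  #|odd_nbrs j| = dc \/ #|odd_nbrs j|.+2 = dc.
Proof.
move=> b0 /forall_inP /(_ [set j]); rewrite cards1 => /(_ b0) Ej.
have N_odd : odd #|odd_nbrs j| = odd dc.
  rewrite -[in RHS](sum_mult1 j) -sum1dep_card big_mkcond /=.
  rewrite !(big_morph odd oddD (erefl (odd 0))); apply: eq_bigr => v _.
  by case: ifP.
have Nr : 2 * #|reach [set j]| <= #|odd_nbrs j| + dc.
  rewrite -[X in _ <= _ + X](sum_mult1 j) -[X in _ * X <= _]sum1_card.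
  rewrite -[X in _ <= X + _]sum1_card big_distrr /= big_mkcond /=.
  rewrite [X in _ <= X + _]big_mkcond -big_split; apply: leq_sum => v _ /=.
  rewrite mem_reach inE; case: (mult _ v) => [|[|k]] //=; lia.
have Nd : #|odd_nbrs j| <= dc.
  rewrite -[X in _ <= X](sum_mult1 j) -sum1_card big_mkcond /=.
  by apply: leq_sum => v _; rewrite inE; case: (mult _ v) => [|k] //; case: ifP.
lia.
Qed.

Lemma repeated_socket j : #|odd_nbrs j| != dc ->
  exists i1 i2, [/\ cs i1 = j, cs i2 = j, vs i1 = vs i2 & i1 != i2].
Proof.
move=> Nj; have [v] : exists v, 1 < mult [set j] v.
  apply/existsP; apply: contraNT Nj; rewrite negb_exists => /forallP le1.
  rewrite -[X in _ == X](sum_mult1 j) -sum1_card big_mkcond; apply/eqP/eq_bigr.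
  by move=> v _; move: (le1 v); rewrite inE; case: (mult _ v) => [|[|]].
move=> /card_gt1P[i1 [i2 []]]; rewrite !inE => /andP[/eqP c1 /eqP v1].
by move=> /andP[/eqP c2 /eqP v2] i12; exists i1, i2; rewrite v1 v2.
Qed.

(* Two equal sockets at a check cancel, so it is left with [dc - 2] neighbours
   and may keep only one of them. *)
Definition kept (j : J) : nat := if #|odd_nbrs j| == dc then 2 else 1.

(** With [dc] neighbours, at least three shared variables give three sockets. Otherwise at least two
    are shared, and a repeated socket supplies the third. *)
Lemma stuck_bad_sockets S K j : stuck odd_nbrs kept S K -> j \in K ->
  3 <= #|[set i | (cs i == j) && ((1 < mult K (vs i)) || (vs i \in S))]|.
Proof.
move=> /forall_inP sK jK; move: (sK j jK).
set P := [set i | _].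
have N_socket v i : v \in odd_nbrs i -> exists2 s, cs s = i & vs s = v.
  rewrite inE => /odd_gt0 /card_gt0P[s]; rewrite inE => /andP[/set1P cs_s /eqP vs_s].
  by exists s.
have multP s1 s2 : cs s1 \in K -> cs s2 \in K -> vs s1 = vs s2 -> s1 != s2 ->
    1 < mult K (vs s1).
  move=> k1 k2 vE s12; apply/card_gt1P; exists s1, s2; split=> //.
    by rewrite inE k1 eqxx.
  by rewrite inE k2 vE eqxx.
have sharedP : shared odd_nbrs S K j \subset vs @: P.
  apply/subsetP => v; rewrite inE => /andP[/N_socket[s cs_s vs_s]] vSK.
  apply/imsetP; exists s; rewrite // inE cs_s eqxx vs_s /=.
  move: vSK; rewrite inE => /orP[->|]; first by rewrite orbT.
  move=> /bigcupP[i]; rewrite in_setD1 => /andP[ij iK] /N_socket[s' cs_s' vs_s'].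
  rewrite -vs_s (multP s s') ?cs_s ?cs_s' ?vs_s ?vs_s' //.
  by apply: contraNneq ij => ss'; rewrite -cs_s -cs_s' ss'.
rewrite /kept; case: ifP => [_|/negbT Nj] lt_shared.
  exact: leq_trans lt_shared (leq_trans (subset_leq_card sharedP) (leq_imset_card _ _)).
have [i1 [i2 [c1 c2 v12 i12]]] := repeated_socket Nj.
have m1 : 1 < mult K (vs i1) by apply: (multP i1 i2); rewrite ?c1 ?c2.
have P1 : i1 \in P by rewrite inE c1 eqxx m1.
have P2 : i2 \in P by rewrite inE c2 eqxx -v12 m1.
(* [i1] and [i2] lie at the same variable, so dropping [i1] does not shrink the image. *)
rewrite (cardsD1 i1 P) P1 ltnS; apply: leq_trans lt_shared _.
apply: leq_trans (leq_imset_card vs _); apply: subset_leq_card.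
apply: subset_trans sharedP _; apply/subsetP => _ /imsetP[i iP ->].
have [->|ne] := eqVneq i i1; apply/imsetP.
  by exists i2; rewrite // in_setD1 eq_sym i12.
by exists i; rewrite // in_setD1 ne.
Qed.

(** Counts sockets of [K] at variables in [S] or hit twice: at least [3 * #|K|], at most
    [2 * (dc * #|K| - #|reach K|) + #|S|], where expansion bounds the difference by [6/5 * #|K|]. *)
Lemma stuck_card b S K : expanding b -> #|K| <= b ->
  stuck odd_nbrs kept S K -> 3 * #|K| <= 5 * #|S|.
Proof.
move=> /forall_inP /(_ K) EK /EK{}EK sK.
pose bad v := (1 < mult K v) || (v \in S).
have lb : 3 * #|K| <= \sum_(v | bad v) mult K v.
  rewrite sum_mult -sum1dep_card (partition_big cs (mem K)) /=; last by move=> i /andP[].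
  rewrite mulnC -sum_nat_const; apply: leq_sum => j jK.
  apply: leq_trans (stuck_bad_sockets sK jK) _; rewrite -sum1dep_card.
  rewrite leq_eqVlt; apply/orP; left; apply/eqP; apply: eq_bigl => i.
  by case: eqP => [->|]; rewrite ?andbF // andbT; move: jK => /= ->.
have ub : \sum_(v | bad v) mult K v + 2 * #|reach K| <= 2 * (dc * #|K|) + #|S|.
  have -> : dc * #|K| = \sum_v mult K v.
    by rewrite sum_mult -card_sockets; apply: eq_card => i; rewrite !inE andbT.
  rewrite -[X in _ + _ * X <= _]sum1_card -[X in _ <= _ + X]sum1_card !big_distrr /=.
  rewrite big_mkcond [X in _ + X <= _]big_mkcond [X in _ <= _ + X]big_mkcond.
  rewrite -!big_split; apply: leq_sum => v _ /=.
  rewrite mem_reach /bad; case: (mult K v) => [|[|k]] /=; case: (v \in S); lia.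
lia.
Qed.

(** [stuck_card] leaves at most one check, which can share only [v] and so can be removed. Hence
    single variables have empty cores and bias [p]. *)
Lemma stuck_set1 b v K : expanding b -> #|K| <= b ->
  stuck odd_nbrs kept [set v] K -> K = set0.
Proof.
move=> Eb Kb sK; have := stuck_card Eb Kb sK; rewrite cards1 => K1.
apply/eqP; rewrite -cards_eq0 -leqn0 leqNgt; apply/negP => K_gt0.
have /eqP/cards1P[j KE] : #|K| = 1 by lia.
move: sK => /forall_inP /(_ j); rewrite KE set11 => /(_ isT).
rewrite ltnNge (leq_trans (_ : _ <= #|[set v]|)) //; last first.
  by rewrite cards1 /kept; case: ifP.
apply: subset_leq_card; apply: subset_trans (subsetIr _ _) _.
rewrite subUset subxx; apply/bigcupsP => i; rewrite !inE.
by case: eqP.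
Qed.

End Sockets.

(** * Counting permutations that map one set into another *)

Section PermCount.
Variable T : finType.
Implicit Types (s : {perm T}) (P Q : {set T}).

Definition perms_into Q P : {set {perm T}} := [set s : {perm T} | [forall x in Q, s x \in P]].

(** By composing with a transposition, all [q'] outside [Q] are sent into [P] equally often; each
    member of [perms_into Q P] does this to exactly [#|P| - #|Q|] of them. *)
Lemma card_perms_intoU1 Q P q : q \notin Q ->
  #|perms_into (q |: Q) P| * (#|T| - #|Q|) = #|perms_into Q P| * (#|P| - #|Q|).
Proof.
move=> qQ.
have swap q' : q' \notin Q ->
    #|[set s in perms_into Q P | s q' \in P]| = #|perms_into (q |: Q) P|.
  move=> q'Q; rewrite -[RHS](card_imset _ (mulgI (tperm q q'))); apply: eq_card => s.
  have fixQ x : x \in Q -> tperm q q' x = x.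
    by move=> xQ; rewrite tpermD //; [move: qQ|move: q'Q]; apply: contraNneq => ->.
  rewrite !inE; apply/andP/imsetP => [[/forall_inP sQ sq']|[s']].
    exists (tperm q q' * s)%g; last by rewrite mulgA tperm2 mul1g.
    rewrite inE; apply/forall_inP => x /setU1P[->|xQ]; rewrite permM ?tpermL //.
    by rewrite fixQ ?sQ.
  rewrite inE => /forall_inP s'Q ->; split.
    by apply/forall_inP => x xQ; rewrite permM fixQ // s'Q // setU1r.
  by rewrite permM tpermR s'Q // setU11.
have cQ : #|T| - #|Q| = #|~: Q| by rewrite -(cardsC Q) addKn.
rewrite cQ mulnC -sum_nat_const.
rewrite (eq_bigr (fun q' => \sum_(s in perms_into Q P) (s q' \in P))); last first.
  move=> q'; rewrite inE => /swap <-; rewrite -sum1dep_card big_mkcondr.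
  by apply: eq_bigr => s _; case: (_ \in P).
rewrite exchange_big -sum_nat_const /=; apply: eq_bigr => s.
rewrite inE => /forall_inP sQ.
have QP : Q \subset s @^-1: P by apply/subsetP => x /sQ; rewrite inE.
rewrite -(card_preimset P (@perm_inj _ s)) -cardsDS // -sum1dep_card.
rewrite [RHS]big_mkcond [LHS]big_mkcond; apply: eq_bigr => x _.
by rewrite !inE; case: (x \in Q).
Qed.

(** Division-free form of the probability bound [(#|P| / #|T|) ^ #|Q|]: each factor
    [(#|P| - i) / (#|T| - i)] is at most [#|P| / #|T|]. *)
Lemma card_perms_into Q P :
  #|perms_into Q P| * #|T| ^ #|Q| <= #|P| ^ #|Q| * #|{perm T}|.
Proof.
move: {2}#|Q| (erefl #|Q|) => k; elim: k Q => [|k IHk] Q' Q'k.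
  by rewrite Q'k !muln1 mul1n max_card.
have /card_gt0P[q qQ'] : 0 < #|Q'| by rewrite Q'k.
rewrite -(setD1K qQ'); set Q := Q' :\ q.
have qQ : q \notin Q by rewrite !inE eqxx.
have /IHk IHQ : #|Q| = k by move: Q'k; rewrite (cardsD1 q) qQ' => -[].
rewrite cardsU1 qQ add1n !expnS.
have QT : #|Q| < #|T|.
  by rewrite -(cardsC Q) -[X in X < _]addn0 ltn_add2l; apply/card_gt0P; exists q; rewrite inE.
have step : #|perms_into (q |: Q) P| * #|T| <= #|perms_into Q P| * #|P|.
  rewrite -(leq_pmul2r (_ : 0 < #|T| - #|Q|)) ?subn_gt0 //.
  rewrite mulnAC card_perms_intoU1 // -!mulnA leq_mul2l; apply/orP; right.
  rewrite mulnBl mulnBr leq_sub2l // [X in X <= _]mulnC leq_mul2l.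
  by rewrite max_card orbT.
by rewrite mulnA; apply: leq_trans (leq_mul step (leqnn _)) _; nia.
Qed.

(** The sockets of checks lie on the image side of [s], while [perms_into] constrains the domain
    side. *)
Lemma card_perms_into_inv Q P :
  #|[set s : {perm T} | [forall x, (s x \in Q) ==> (x \in P)]]| = #|perms_into Q P|.
Proof.
rewrite -[RHS](card_imset _ (@invg_inj _)); apply: eq_card => s.
rewrite inE; apply/forallP/imsetP => [sQ|[s']].
  exists s^-1%g; rewrite ?invgK // inE; apply/forall_inP => x xQ.
  by apply: (implyP (sQ _)); rewrite permKV.
rewrite inE => /forall_inP s'Q -> x; apply/implyP => xQ.
by have := s'Q _ xQ; rewrite permKV.
Qed.

End PermCount.

(** * Binomial estimates *)

Section BinomialBounds.

Lemma leq_exp2rW m n e : m <= n -> m ^ e <= n ^ e.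
Proof. by case: e => // e mn; rewrite leq_exp2r. Qed.

(** The first [n] factors of the falling factorial of [2 * n] are at least [n], and
    ['C(2 * n, n) <= 4 ^ n]. *)
Lemma leq_self_exp_fact n : n ^ n <= 4 ^ n * n`!.
Proof.
apply: (@leq_trans ('C(n + n, n) * n`!)).
  rewrite bin_ffact ffact_prod -[X in _ ^ X](card_ord n) -prod_nat_const.
  by apply: leq_prod => i _; have := ltn_ord i; lia.
rewrite leq_mul2r; apply/orP; right.
rewrite (_ : 4 ^ n = 2 ^ (n + n)); last by rewrite addnn -mul2n expnM.
rewrite -[2]/(1 + 1) expnDn (bigD1 (inord n : 'I_(n + n).+1)) //=.
by rewrite inordK ?ltnS ?leq_addr // !exp1n !muln1 leq_addr.
Qed.

Lemma leq_bin_exp N k : 'C(N, k) * k ^ k <= (4 * N) ^ k.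
Proof.
apply: (@leq_trans ('C(N, k) * k`! * 4 ^ k)).
  by rewrite -mulnA leq_mul2l (mulnC k`!) leq_self_exp_fact orbT.
rewrite expnMn mulnC leq_mul2l bin_ffact ffact_prod; apply/orP; right.
rewrite -[X in _ <= _ ^ X](card_ord k) -prod_nat_const.
by apply: leq_prod => i _; apply: leq_subr.
Qed.

(* The union bound over [s] checks whose [dc * s] sockets reach only
   [a = dc * s - s - u] variables. *)
Lemma union_term_bound dv dc n m s u a :
  m <= dv * n -> dc * s = a + s + u -> u <= s -> 0 < dc ->
  'C(m, s) * 'C(n, a) * a ^ (dc * s) * n ^ u <=
  (4 * dv * 4 ^ dc * dc ^ 2) ^ s * s ^ u * n ^ (dc * s).
Proof.
move=> mn ds us dc0.
have b1 : 'C(m, s) * s ^ s <= (4 * dv) ^ s * n ^ s.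
  by rewrite -expnMn (leq_trans (leq_bin_exp m s)) // -mulnA leq_exp2rW // leq_mul.
have b2 : 'C(n, a) * a ^ a <= 4 ^ (dc * s) * n ^ a.
  apply: leq_trans (leq_bin_exp n a) _; rewrite expnMn leq_mul2r.
  by rewrite leq_pexp2l ?orbT // ds; lia.
have b3 : a ^ (s + u) <= dc ^ (2 * s) * s ^ s * s ^ u.
  rewrite -mulnA -expnD; apply: (@leq_trans ((dc * s) ^ (s + u))).
    by rewrite leq_exp2rW // ds; lia.
  by rewrite expnMn leq_mul2r leq_pexp2l ?orbT //; lia.
(* Of the [dc * s] factors [a], the first [a] compensate ['C(n, a)] and the other [s + u] are
   bounded by [dc * s]. *)
have -> : 'C(m, s) * 'C(n, a) * a ^ (dc * s) * n ^ u =
    'C(m, s) * ('C(n, a) * a ^ a) * a ^ (s + u) * n ^ u.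
  by rewrite {1}ds -addnA expnD !mulnA.
apply: (@leq_trans ('C(m, s) * (4 ^ (dc * s) * n ^ a) *
    (dc ^ (2 * s) * s ^ s * s ^ u) * n ^ u)).
  by rewrite leq_mul // leq_mul // leq_mul.
apply: (@leq_trans (((4 * dv) ^ s * n ^ s) * (4 ^ (dc * s) * n ^ a) *
    (dc ^ (2 * s) * s ^ u) * n ^ u)).
  rewrite leq_mul2r; apply/orP; right.
  rewrite (_ : _ * _ = ('C(m, s) * s ^ s) * (4 ^ (dc * s) * n ^ a) *
    (dc ^ (2 * s) * s ^ u)); last by rewrite !mulnA; lia.
  by rewrite leq_mul2r leq_mul2r b1 !orbT.
by rewrite {2}ds !expnMn -!expnM !expnD; lia.
Qed.
End BinomialBounds.

(** * Union bound over small sets of checks *)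

Section UnionBound.

Lemma geometric_sum_bound b X (t : nat -> nat) :
  (forall s, 0 < s <= b -> t s * 2 ^ s <= X) -> \sum_(1 <= s < b.+1) t s <= X.
Proof.
(* The induction carries the sharper bound [X * (1 - 2 ^ - b)]. *)
move=> tX; suff H : 2 ^ b * \sum_(1 <= s < b.+1) t s + X <= 2 ^ b * X.
  rewrite -(leq_pmul2l (_ : 0 < 2 ^ b)) ?expn_gt0 //.
  exact: leq_trans (leq_addr X _) H.
elim: b tX => [|b IHb] tX; first by rewrite big_geq // muln0 mul1n.
have /IHb IH : forall s, 0 < s <= b -> t s * 2 ^ s <= X.
  by move=> s sb; apply: tX; lia.
rewrite big_nat_recr // expnS; move: IH (tX b.+1 (leqnn _)); rewrite expnS.
move: (2 ^ b) (\sum_(1 <= i < _) _) (t b.+1) => x S y.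
by rewrite -[_ S y]/(S + y); nia.
Qed.

Lemma leq_card_bigcup (I T : finType) (P : pred I) (F : I -> {set T}) :
  #|\bigcup_(i | P i) F i| <= \sum_(i | P i) #|F i|.
Proof.
apply: (big_ind2 (fun (A : {set T}) n => #|A| <= n)); rewrite ?cards0 //.
by move=> A k B l Ak Bl; apply: leq_trans (leq_card_setU A B) (leq_add Ak Bl).
Qed.

Variables (T V J : finType) (vs : T -> V) (ck : T -> J) (dv dc : nat).
Hypothesis vs_card : forall v, #|[set i | vs i == v]| = dv.
Hypothesis ck_card : forall j, #|[set i | ck i == j]| = dc.
Hypotheses (dv_gt0 : 0 < dv) (dc_gt1 : 1 < dc).

Definition non_expanding b : {set {perm T}} :=
  [set s : {perm T} | ~~ expanding vs (fun i => ck (s i)) dc b].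

(** For positive [s], the largest integer below [(dc - 6/5) * s]. *)
Definition critical_size s : nat := dc * s - s - (s %/ 5).+1.

Definition trapped_perms (s : nat) : {set {perm T}} :=
  \bigcup_(K in [set K : {set J} | #|K| == s])
  \bigcup_(A in [set A : {set V} | #|A| == critical_size s])
    [set g : {perm T} | [forall i, (ck (g i) \in K) ==> (vs i \in A)]].

(** For fixed [K] and [A], the [dc * s] sockets of [K] must all meet the [dv * critical_size s]
    sockets of [A]; the powers of [dv] cancel. *)
Lemma card_trapped_perms s :
  #|trapped_perms s| * #|V| ^ (dc * s) <=
  'C(#|J|, s) * 'C(#|V|, critical_size s) * critical_size s ^ (dc * s) * #|{perm T}|.
Proof.
have cT : #|T| = dv * #|V|.
  by rewrite -[#|V|]cardsT -(card_sockets vs_card) -cardsT; apply: eq_card => i; rewrite !inE.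
have one (K : {set J}) (A : {set V}) : #|K| = s -> #|A| = critical_size s ->
    #|[set g : {perm T} | [forall i, (ck (g i) \in K) ==> (vs i \in A)]]| *
      #|V| ^ (dc * s) <= critical_size s ^ (dc * s) * #|{perm T}|.
  move=> Ks Aa; have := card_perms_into [set i | ck i \in K] [set i | vs i \in A].
  rewrite -card_perms_into_inv (card_sockets ck_card) (card_sockets vs_card) Ks Aa cT.
  rewrite !expnMn mulnCA -mulnA leq_pmul2l ?expn_gt0 ?dv_gt0 //.
  congr (_ * _ <= _); apply: eq_card => g; rewrite !inE; apply: eq_forallb => i.
  by rewrite !inE.
rewrite -(card_draws J) -(card_draws V) -!mulnA -[X in _ <= X]sum_nat_const.
apply: leq_trans (leq_mul (leq_card_bigcup _ _) (leqnn _)) _.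
rewrite big_distrl; apply: leq_sum => K; rewrite inE => /eqP Ks.
rewrite -[X in _ <= X]sum_nat_const.
apply: leq_trans (leq_mul (leq_card_bigcup _ _) (leqnn _)) _.
by rewrite big_distrl; apply: leq_sum => A; rewrite inE => /eqP /one; apply.
Qed.

Lemma non_expanding_trapped b : dc * b <= #|V| ->
  #|non_expanding b| <= \sum_(1 <= s < b.+1) #|trapped_perms s|.
Proof.
move=> bV; apply: (@leq_trans #|\bigcup_(s < b.+1 | 0 < s) trapped_perms s|).
  apply: subset_leq_card; apply/subsetP => g; rewrite inE => /forall_inPn[K].
  rewrite -ltnNge => Kb Kreach.
  have K0 : 0 < #|K| by move: Kreach; case: #|K| => //; rewrite !muln0.
  have Kb' : #|K| < b.+1 by [].
  apply/bigcupP; exists (Ordinal Kb') => //=.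
  set R := reach _ _ _ in Kreach.
  have aV : critical_size #|K| <= #|V|.
    by apply: leq_trans bV; rewrite /critical_size; nia.
  have Ra : #|R| <= critical_size #|K|.
    by rewrite /critical_size; move: Kreach; move: (dc * _) => x; lia.
  (* The reached set is padded to exactly the critical size, for which [bV] provides enough
     variables. *)
  have [|B [RB _] cB] := @setI_extend _ R setT (critical_size #|K|).
    by rewrite setTI cardsT Ra aV.
  rewrite setTI in RB.
  apply/bigcupP; exists K; first by rewrite inE.
  apply/bigcupP; exists B; first by rewrite inE cB.
  rewrite inE; apply/forallP => i; apply/implyP => iK.
  by apply: (subsetP RB); apply: imset_f; rewrite inE.
apply: leq_trans (leq_card_bigcup _ _) _.
by rewrite [X in _ <= X]big_geq_mkord.
Qed.

(** With [u = s %/ 5 + 1], sets of [s] checks fail with probability at most [(C ^ 5 * s / n) ^ u].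
    One factor gives [1 / n]; the others, at most [1 / 1024] each, pay for [s * 2 ^ s]. *)
Lemma card_non_expanding b (C := 4 * dv * 4 ^ dc * dc ^ 2) :
  #|J| <= dv * #|V| -> dc * b <= #|V| -> 1024 * C ^ 5 * b <= #|V| ->
  #|non_expanding b| * #|V| <= 256 * C ^ 5 * #|{perm T}|.
Proof.
move=> JV bV CbV; have [->|V0] := posnP #|V|; first by rewrite muln0.
have C0 : 0 < C by rewrite /C !muln_gt0 !expn_gt0 dv_gt0 (ltnW dc_gt1).
apply: leq_trans (leq_mul (non_expanding_trapped bV) (leqnn _)) _.
rewrite big_distrl /=; apply: geometric_sum_bound => s /andP[s0 sb].
set t := #|trapped_perms s|; set n := #|V| in V0 CbV *; set P := #|{perm T}|.
pose v := s %/ 5; pose u := v.+1.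
have us : u <= s by rewrite /u /v; lia.
have su : s <= 5 * u by rewrite /u /v; lia.
have ds : dc * s = critical_size s + s + u by rewrite /critical_size -/v -/u; nia.
have t1 : t * n ^ u <= C ^ s * s ^ u * P.
  rewrite -(leq_pmul2r (_ : 0 < n ^ (dc * s))) ?expn_gt0 ?V0 // mulnAC.
  apply: leq_trans (leq_mul (card_trapped_perms s) (leqnn _)) _.
  rewrite mulnAC -[X in _ <= X]mulnAC leq_mul2r; apply/orP; right.
  exact: union_term_bound JV ds us (ltnW dc_gt1).
have t2 : C ^ s * s ^ u <= (C ^ 5 * s) ^ u.
  by rewrite expnMn leq_mul2r -expnM leq_pexp2l // orbT.
have t3 : (1024 * (C ^ 5 * s)) ^ v <= n ^ v.
  apply: leq_exp2rW; apply: leq_trans CbV; rewrite mulnA.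
  by rewrite leq_mul2l sb orbT.
(* Since [s <= 5 * v + 4], [2 ^ (2 * s) <= 2 ^ (10 * v + 8)], whence 1024 and 256. *)
have t4 : s * 2 ^ s <= 256 * 1024 ^ v.
  apply: (@leq_trans (2 ^ s * 2 ^ s)); first by rewrite leq_mul2r ltnW ?orbT // ltn_expl.
  rewrite -expnD -[256]/(2 ^ 8) -[1024]/(2 ^ 10) -expnM -expnD leq_pexp2l //.
  by rewrite /v; lia.
have uE : u = v.+1 by [].
clearbody C n t P u v.
rewrite -(leq_pmul2r (_ : 0 < n ^ u * 1024 ^ v)) ?muln_gt0 ?expn_gt0 ?V0 //.
apply: (@leq_trans (n * 2 ^ s * 1024 ^ v * ((C ^ 5 * s) ^ u * P))).
  rewrite (_ : t * n * _ * _ = n * 2 ^ s * 1024 ^ v * (t * n ^ u)); last by lia.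
  by rewrite leq_mul2l (leq_trans t1) ?orbT // leq_mul2r t2 orbT.
apply: (@leq_trans (n * (C ^ 5) * P * n ^ v * (s * 2 ^ s))).
  rewrite uE expnS (_ : _ * _ = n * C ^ 5 * P * (s * 2 ^ s) *
    (1024 ^ v * (C ^ 5 * s) ^ v)); last by lia.
  by rewrite -expnMn mulnAC leq_mul2r leq_mul2l t3 !orbT.
rewrite (_ : 256 * _ * _ * _ = n * C ^ 5 * P * n ^ v * (256 * 1024 ^ v));
  last by rewrite uE (expnS n); lia.
by rewrite leq_mul2l t4 orbT.
Qed.

End UnionBound.

(** * Grouping sockets into consecutive blocks *)

Section Blocks.
Variables (q d N : nat).
Hypothesis NE : N = q * d.

Lemma block_subproof (i : 'I_N) : i %/ d < q.
Proof.
have := ltn_ord i; rewrite [X in _ < X]NE; case: (posnP d) => [->|d0].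
  by rewrite muln0.
by rewrite ltn_divLR.
Qed.

Definition block (i : 'I_N) : 'I_q := Ordinal (block_subproof i).

Lemma card_block v : #|[set i | block i == v]| = d.
Proof.
have lt (r : 'I_d) : v * d + r < N.
  by rewrite NE; have := ltn_ord v; have := ltn_ord r; nia.
pose f r := Ordinal (lt r).
have f_inj : injective f.
  by move=> r r' /(congr1 val) /addnI /val_inj.
rewrite -[RHS](card_ord d) -(card_imset _ f_inj); apply: eq_card => i.
rewrite inE; apply/eqP/imsetP => [iv|[r _ ->]].
  have d0 : 0 < d.
    by have := ltn_ord i; rewrite [X in _ < X]NE; case: (posnP d) => // ->; rewrite muln0.
  by exists (Ordinal (ltn_pmod i d0)) => //; apply: val_inj; rewrite /= -iv /= -divn_eq.
by apply: val_inj; rewrite /= divnMDl ?(divn_small (ltn_ord r)) ?addn0 //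
  (leq_ltn_trans _ (ltn_ord r)).
Qed.

End Blocks.

Local Open Scope ring_scope.

(** * The Sherali-Adams solution *)

Section Family.
Variables (R : realType) (V J : finType) (N : J -> {set V}) (r : J -> nat) (t : nat).
Variables (p : R) (phi : J -> nat -> R).
Hypothesis p01 : 0 <= p <= 1.
Hypothesis phi_ge0 : forall j w, 0 <= phi j w.
Hypothesis phi_mean : forall j, unit_mean p #|N j| (r j) (phi j).
Hypothesis r_lt : forall j, (r j < #|N j|)%N.
Hypothesis stuck_small : forall (S : {set V}) (K : {set J}),
  (#|S| <= t)%N -> (#|K| <= 4 * t)%N -> stuck N r S K -> (#|K| <= 2 * #|S|)%N.
Implicit Types (S T : {set V}) (x : {ffun V -> bool}).

Definition restrict S x : asg bool S := [ffun u => x (val u)].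

Definition SA_family S (alpha : asg bool S) : R :=
  \sum_x cube_weight p x *
    ((restrict S x == alpha)%:R * joint_density N phi (core N r t S) x).

Lemma joint_density_ge0 K x : 0 <= joint_density N phi K x.
Proof. by apply: prodr_ge0. Qed.

Lemma joint_density0 x : joint_density N phi finset.set0 x = 1.
Proof. by rewrite /joint_density big_set0. Qed.

Lemma depends_on_restrict S (alpha : asg bool S) :
  depends_on S (fun x => (restrict S x == alpha)%:R : R).
Proof.
move=> x y xy; congr ((_ == _)%:R); apply/ffunP => u; rewrite !ffunE.
by apply: xy; exact: valP.
Qed.

Lemma restrict_asg_union S T (alpha : asg bool S) (beta : asg bool (T :\: S)) x :
  S \subset T ->
  (restrict T x == asg_union alpha beta) =
  (restrict S x == alpha) && (restrict (T :\: S) x == beta).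
Proof.
move=> ST; apply/eqP/andP => [xT|[/eqP <- /eqP <-]]; last first.
  by apply/ffunP => u; rewrite !ffunE; destruct (boolP _) as [uS|uS]; rewrite ffunE.
split; apply/eqP/ffunP => -[u uS].
  have uT := subsetP ST _ uS.
  move: (congr1 (fun f : asg bool T => f (exist _ u uT)) xT); rewrite !ffunE /=.
  destruct (boolP _) as [uS'|uS']; last by case/negP: uS'.
  by rewrite (bool_irrelevance uS' uS).
have := uS; rewrite in_setD => /andP[uNS uT].
move: (congr1 (fun f : asg bool T => f (exist _ u uT)) xT); rewrite !ffunE /=.
destruct (boolP _) as [uS'|uS']; first by case/negP: uNS.
by move=> ->; congr (beta (exist _ _ _)); apply: bool_irrelevance.
Qed.

Lemma SA_family_consistent S T (alpha : asg bool S) :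
  S \subset T -> (#|T| <= t)%N ->
  \sum_(beta : asg bool (T :\: S)) SA_family (asg_union alpha beta) = SA_family alpha.
Proof.
move=> ST Tt; rewrite /SA_family.
have r_le j : (r j <= #|N j|)%N by apply: ltnW.
rewrite -(sum_core stuck_small phi_mean r_le (depends_on_restrict alpha) ST Tt).
rewrite exchange_big /=; apply: eq_bigr => x _.
rewrite -big_distrr -big_distrl /=; congr (_ * (_ * _)).
under eq_bigr do rewrite restrict_asg_union //.
case: (_ == alpha) => /=; last by rewrite big1.
rewrite (bigD1 (restrict (T :\: S) x)) //= eqxx big1 ?addr0 // => beta.
by rewrite eq_sym => /negbTE ->.
Qed.

Lemma SA_family_local : local_distribution t SA_family.
Proof.
split=> [S alpha St|alpha|]; last exact: SA_family_consistent.
- apply/andP; split.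
    apply: sumr_ge0 => x _; rewrite mulr_ge0 ?cube_weight_ge0 //.
    by rewrite mulr_ge0 ?joint_density_ge0 ?ler0n.
  (* The upper bound compares with the total mass, which is one by [sum_core] for the empty set. *)
  have r_le j : (r j <= #|N j|)%N by apply: ltnW.
  have h1 : depends_on finset.set0 (fun _ : {ffun V -> bool} => 1 : R) by [].
  have := sum_core stuck_small phi_mean r_le h1 (sub0set S) St.
  rewrite (core0 stuck_small).
  under [RHS]eq_bigr do rewrite joint_density0 !mulr1.
  rewrite sum_cube_weight => <-; apply: ler_sum => x _.
  rewrite ler_wpM2l ?cube_weight_ge0 // ler_wpM2r ?joint_density_ge0 //.
  by case: (_ == _).
- rewrite /SA_family (core0 stuck_small) -[RHS](sum_cube_weight V p).
  apply: eq_bigr => x _; rewrite joint_density0 mulr1.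
  rewrite (_ : _ == _ = true) ?mulr1 //; apply/eqP/ffunP => -[u u0].
  by exfalso; rewrite inE in u0.
Qed.

Lemma SA_family_marginal v : core N r t [set v] = finset.set0 -> marginal1 SA_family v = p.
Proof.
move=> core_v; rewrite /marginal1 /SA_family core_v.
(* The indicator only affects the factor of [v], so the sum splits into one-bit sums. *)
pose F u b := bit_weight p b * (if u == v then (b : nat)%:R else 1).
transitivity (\sum_(x : {ffun V -> bool}) \prod_u F u (x u)).
  apply: eq_bigr => x _; rewrite big_split joint_density0 mulr1 /=; congr (_ * _).
  rewrite -big_mkcond /= big_pred1_eq; congr (_%:R); congr nat_of_bool.
  apply/eqP/idP => [/ffunP /(_ (exist _ v (set11 v)))|xv]; rewrite ?ffunE //.
  by apply/ffunP => -[u uv]; rewrite !ffunE /=; move/set1P: uv => ->.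
rewrite -(bigA_distr_bigA F) (bigD1 v) //= [X in _ * X]big1 ?mulr1 => [|u uv].
  by rewrite big_bool /F eqxx /bit_weight /= mulr1 mulr0 addr0.
by rewrite big_bool /F (negbTE uv) /bit_weight /= !mulr1 addrCA subrr addr0.
Qed.

End Family.

(** * Nearest Codeword instances *)

Section NearestCodeword.
Variables (R : realType) (n m : nat) (B : 'I_n -> 'I_m -> bool) (r : 'I_m -> nat).
Variables (t : nat) (p : R).

Lemma scope_set_nearest_codeword s j :
  scope_set (nearest_codeword B s j) = neighbors B j.
Proof.
apply/setP => v; apply/imsetP/idP => [[i _ ->]|vN]; first exact: enum_valP.
by exists (enum_rank_in vN v); rewrite ?inE //; exact: esym (enum_rankK_in vN vN).
Qed.

(** The received vector enters only through the parities required of the checks, so hypotheses on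
    the graph alone serve every [s]. *)
Lemma has_biased_SA_solutionsP :
  (0 < n)%N -> 0 <= p <= 1 ->
  (forall j, (r j < #|neighbors B j| <= t)%N) ->
  (forall j b, exists phi, parity_density p #|neighbors B j| (r j) b phi) ->
  (forall (S : {set 'I_n}) (K : {set 'I_m}),
    (#|S| <= t)%N -> (#|K| <= 4 * t)%N -> stuck (neighbors B) r S K ->
    (#|K| <= 2 * #|S|)%N) ->
  (forall v (K : {set 'I_m}), (#|K| <= 4 * t)%N ->
    stuck (neighbors B) r [set v] K -> K = finset.set0) ->
  has_biased_SA_solutions t p B.
Proof.
move=> n0 p01 Nt dens small small1 s.
pose par j := odd (\sum_(v in neighbors B j) s v).
have /fin_all_exists[phi phiP] j : exists phi,
    parity_density p #|neighbors B j| (r j) (par j) phi by apply: dens.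
have phi0 j w : 0 <= phi j w by case: (phiP j).
have phiN j w : odd w != par j -> phi j w = 0 by case: (phiP j) => _ /(_ w).
have phi1 j : unit_mean p #|neighbors B j| (r j) (phi j) by case: (phiP j).
have r_lt j : (r j < #|neighbors B j|)%N by case/andP: (Nt j).
have N_le j : (#|neighbors B j| <= t)%N by case/andP: (Nt j).
exists (SA_family (neighbors B) r t p phi).
have marg v : marginal1 (SA_family (neighbors B) r t p phi) v = p.
  apply: SA_family_marginal; apply: big1 => K /andP[sK Kt].
  by apply: small1 sK; apply: leq_trans Kt _; rewrite leq_mul2r orbT.
split=> //.
- by split=> [j|]; [exact: N_le|exact: SA_family_local].
- move=> j alpha; rewrite inE => bad; apply: big1 => x _.
  have [xa|_] := eqVneq; last by rewrite mul0r mulr0.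
  have jc : j \in core (neighbors B) r t (scope_set (nearest_codeword B s j)).
    by rewrite scope_set_nearest_codeword; apply: mem_core.
  rewrite /joint_density (bigD1 j) //= phiN ?mul0r ?mulr0 //.
  apply: contraNneq bad => eq_par; apply/eqP; rewrite -[RHS]eq_par; congr odd.
  rewrite /ones -sum1dep_card big_mkcondr /= [RHS]big_enum_val /=.
  by apply: eq_bigr => i _; rewrite -xa !ffunE /=; case: (x _).
- rewrite /SA_value; under eq_bigr do rewrite marg.
  by rewrite sumr_const card_ord -[p *+ n]mulr_natl mulrA mulVf ?mul1r // pnatr_eq0 -lt0n.
Qed.

End NearestCodeword.

Lemma bias_itv (R : realType) dc : (5 <= dc)%N -> 0 <= bias R dc <= 1.
Proof.
move=> dc5; rewrite /bias; case: ifP => dco.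
  by have /andP[/ltW -> /ltW ->] // := @invr_natr_itv R (dc - 3) ltac:(lia).
by have /andP[/ltW -> /ltW ->] // := @invr_natr_itv R (dc - 4) ltac:(lia).
Qed.

(** The bias is [1 / y] with [y] even; the arities [dc] and [dc - 2] are [y + 3] and [y + 1] for odd
    [dc], [y + 4] and [y + 2] for even [dc]. *)
Lemma bias_density (R : realType) dc k b : (5 <= dc)%N ->
  k = dc \/ k.+2 = dc ->
  exists phi, parity_density (bias R dc) k (if k == dc then 2 else 1) b phi.
Proof.
move=> dc5 kE; rewrite /bias; case: ifP => dco.
  have y2 : (2 <= dc - 3)%N by lia.
  have yo : ~~ odd (dc - 3) by lia.
  case: kE => kE.
    rewrite kE eqxx -[X in parity_density _ X](subnK (ltnW (ltnW dc5))).
    exact: pair_density_odd_arity.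
  rewrite ifF; last by lia.
  by rewrite (_ : k = dc - 3 + 1)%N; [apply: single_density_odd_arity|lia].
have y2 : (2 <= dc - 4)%N by lia.
have yo : ~~ odd (dc - 4) by lia.
case: kE => kE.
  rewrite kE eqxx -[X in parity_density _ X](subnK (ltnW dc5)).
  exact: pair_density_even_arity.
rewrite ifF; last by lia.
by rewrite (_ : k = dc - 4 + 2)%N; [apply: single_density_even_arity|lia].
Qed.

(** * Random LDPC graphs *)

Section LDPC.
Variables (n dv dc : nat).
Hypotheses (n_gt0 : (0 < n)%N) (dv_gt0 : (0 < dv)%N) (dc_ge5 : (5 <= dc)%N).
Hypothesis dc_dvd : (dc %| n * dv)%N.

Local Notation m := (n * dv %/ dc)%N.

Definition socket_var : 'I_(n * dv) -> 'I_n := block (erefl (n * dv)%N).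

Definition socket_check : 'I_(n * dv) -> 'I_m := block (esym (divnK dc_dvd)).

Lemma neighbors_ldpc (g : {perm 'I_(n * dv)}) :
  neighbors (@ldpc_graph n m dv dc g) =
  odd_nbrs socket_var (fun i => socket_check (g i)).
Proof.
apply/funext => j; apply/setP => v; rewrite !inE; congr odd; apply: eq_card => i.
by rewrite !inE andbC.
Qed.

Lemma has_biased_SA_solutions_expanding (R : realType) t (g : {perm 'I_(n * dv)}) :
  (dc <= t)%N -> expanding socket_var (fun i => socket_check (g i)) dc (4 * t) ->
  has_biased_SA_solutions t (bias R dc) (@ldpc_graph n m dv dc g).
Proof.
move=> dct expg; set cs := fun i => socket_check (g i).
have cs_card j : #|[set i | cs i == j]| = dc.
  apply: etrans (card_block (esym (divnK dc_dvd)) j).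
  rewrite -[RHS](card_preimset _ (@perm_inj _ g)).
  by apply: eq_card => i; rewrite !inE.
have t0 : (0 < 4 * t)%N by lia.
have Ncard j := card_odd_nbrs cs_card j t0 expg.
apply: (@has_biased_SA_solutionsP _ _ _ _ (kept socket_var cs dc)) => //.
- exact: bias_itv.
- move=> j; rewrite neighbors_ldpc /kept.
  move: (Ncard j); rewrite -/cs; move: #|_| => k kE; by case: eqP => kdc; lia.
- move=> j b; rewrite neighbors_ldpc /kept; apply: bias_density => //.
- move=> S K _ Kt; rewrite neighbors_ldpc => sK.
  by have := stuck_card cs_card expg Kt sK; move: #|K| #|S| => k l; lia.
- move=> v K Kt; rewrite neighbors_ldpc => sK.
  by apply: (stuck_set1 cs_card expg Kt sK).
Qed.

End LDPC.

Lemma equiprob_ge (R : realType) (T : finType) (E : T -> Prop) (A : {set T}) :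
  (forall x, x \notin A -> E x) -> (0 < #|T|)%N ->
  1 - #|A|%:R / #|T|%:R <= equiprob R E <= 1.
Proof.
move=> AE T0; have T0' : 0 < #|T|%:R :> R by rewrite ltr0n.
rewrite /equiprob ler_pdivrMr // mul1r ler_nat max_card andbT.
rewrite -[X in X - _](divff (lt0r_neq0 T0')) -mulrBl ler_pM2r ?invr_gt0 //.
rewrite lerBlDr -natrD ler_nat -(cardsC A) addnC leq_add2r.
by apply: subset_leq_card; apply/subsetP => x; rewrite !inE => /AE Ex; apply/asboolP.
Qed.

Local Open Scope classical_set_scope.
Local Open Scope ring_scope.

Theorem theorem1 (R : realType) (dv dc : nat) (hdv : (1 <= dv)%N)
    (hdc : (5 <= dc)%N) :
  exists2 eta : R, 0 < eta &
    (fun n : nat =>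
       equiprob R (fun pi : {perm 'I_(n * dv)} =>
         has_biased_SA_solutions (Num.truncn (eta * n%:R)) (bias R dc)
           (@ldpc_graph n (n * dv %/ dc) dv dc pi)))
      @ within [set n : nat | (dc %| n * dv)%N] \oo --> (1 : R).
Proof.
pose C := (4 * dv * 4 ^ dc * dc ^ 2)%N.
(* Expansion is needed up to [4 * t] checks: [4096 = 4 * 1024] and [4 * dc] provide the size
   hypotheses of [card_non_expanding]. *)
pose L := (4096 * C ^ 5 + 4 * dc)%N.
have L0 : (0 < L)%N by rewrite /L; lia.
exists L%:R^-1; first by rewrite invr_gt0 ltr0n.
apply/cvgrPdist_le => e e0.
rewrite near_withinE.
pose M := Num.truncn ((256 * C ^ 5)%:R / e).
near=> n => dvd_n.
(* [dc * L] makes [t >= dc], so that every scope fits; [M.+1] makes the failure probability at most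
   [e]. *)
have n_big : (dc * L + M.+1 <= n)%N by near: n; exists (dc * L + M.+1)%N.
set t := Num.truncn _.
have tL : (L * t <= n)%N.
  rewrite -(ler_nat R) natrM -ler_pdivlMl ?ltr0n //.
  by rewrite truncn_le mulr_ge0 ?invr_ge0 ?ler0n.
have dct : (dc <= t)%N.
  rewrite /t truncn_ge_nat ?mulr_ge0 ?invr_ge0 ?ler0n // ler_pdivlMl ?ltr0n // -natrM ler_nat.
  by rewrite mulnC; lia.
have n0 : (0 < n)%N by lia.
set cs := socket_check dvd_n.
pose bad := non_expanding (@socket_var n dv) cs dc (4 * t).
have P0 : (0 < #|{perm 'I_(n * dv)}|)%N by apply/card_gt0P; exists 1%g.
have /andP[lb ub] : 1 - #|bad|%:R / #|{perm 'I_(n * dv)}|%:R <= equiprob R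
    (fun pi : {perm 'I_(n * dv)} => has_biased_SA_solutions t (bias R dc)
      (@ldpc_graph n (n * dv %/ dc) dv dc pi)) <= 1.
  apply: equiprob_ge P0 => g; rewrite inE negbK.
  exact: has_biased_SA_solutions_expanding.
have bad_le : (#|bad| * n <= 256 * C ^ 5 * #|{perm 'I_(n * dv)}|)%N.
  have := @card_non_expanding _ _ _ (@socket_var n dv) cs dv dc
    (card_block _) (card_block _) hdv (ltnW (ltnW (ltnW hdc))) (4 * t).
  rewrite !card_ord; apply.
  - by rewrite mulnC leq_div.
  - by rewrite -/C; move: tL; rewrite /L; move: (C ^ 5)%N => x; nia.
  - by rewrite -/C; move: tL; rewrite /L; move: (C ^ 5)%N => x; nia.
rewrite ger0_norm ?subr_ge0 //; apply: (@le_trans _ _ (#|bad|%:R / #|{perm 'I_(n * dv)}|%:R)).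
  by rewrite lerBlDr -lerBlDl.
apply: (@le_trans _ _ ((256 * C ^ 5)%:R / n%:R)).
  rewrite ler_pdivrMr ?ltr0n // mulrAC ler_pdivlMr ?ltr0n //.
  by rewrite -!natrM ler_nat.
rewrite ler_pdivrMr ?ltr0n // mulrC -ler_pdivrMr //.
have /andP[_ /ltW /le_trans-> //] : M%:R <= (256 * C ^ 5)%:R / e < M.+1%:R.
  by apply: truncn_itv; rewrite divr_ge0 ?ler0n // ltW.
by rewrite ler_nat; lia.
Unshelve. all: by end_near.
Qed.
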